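(* Let $(A,\mu,\alpha)$ be a left Hom-alternative algebra over $\mathbb{K}$, and let $\delta^1:\mathcal{C}^1(A,A)\to\mathcal{C}^2(A,A)$ and $\delta^2:\mathcal{C}^2(A,A)\to\mathcal{C}^3(A,A)$ be its first and second differentials. Then the composite $\delta^2\circ\delta^1$ is zero.
   Context: $\mathbb{K}$ is an algebraically closed field of characteristic zero. A left Hom-alternative algebra is a triple $(A,\mu,\alpha)$ consisting of a $\mathbb{K}$-vector space $A$, a bilinear map $\mu:A\times A\to A$ (equivalently a linear map $A\otimes A\to A$) and a linear map $\alpha:A\to A$ such that $\mu(\alpha(x),\mu(x,y))=\mu(\mu(x,x),\alpha(y))$ for all $x,y\in A$; equivalently (by linearization) $\mu(\alpha(x),\mu(y,z))-\mu(\mu(x,y),\alpha(z))+\mu(\alpha(y),\mu(x,z))-\mu(\mu(y,x),\alpha(z))=0$ for all $x,y,z\in A$. $\mathcal{C}^1(A,A)$ is the set of linear maps $f:A\to A$ which commute with $\alpha$; $\mathcal{C}^2(A,A)$ is the set of bilinear maps on $A$ with values in $A$; $\mathcal{C}^3(A,A)$ is the set of trilinear maps on $A$ with values in $A$. For $f\in\mathcal{C}^1(A,A)$, $\delta^1 f=\mu\circ(f\otimes \mathrm{id})+\mu\circ(\mathrm{id}\otimes f)-f\circ\mu$. For $\phi\in\mathcal{C}^2(A,A)$, $\delta^2\phi=[\mu\circ(\phi\otimes\alpha-\alpha\otimes\phi)+\phi\circ(\mu\otimes\alpha-\alpha\otimes\mu)]\circ(\mathrm{id}^{\otimes 3}+\sigma_1)$,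 where $\sigma_1(x\otimes y\otimes z)=y\otimes x\otimes z$ on $A^{\otimes 3}$. *)

(* Defs.v *)
From HB Require Import structures.
From mathcomp Require Import all_boot all_order all_algebra.

Set Implicit Arguments.
Unset Strict Implicit.
Unset Printing Implicit Defensive.

Import GRing.Theory.
Local Open Scope ring_scope.

Section HomAlternative.
Variables (K : fieldType) (A : lmodType K).

Definition left_hom_alternative
    (mu : {bilinear A -> A -> A}) (alpha : {linear A -> A}) : Prop :=
  forall x y : A, mu (alpha x) (mu x y) = mu (mu x x) (alpha y).

Record cochain1 (alpha : {linear A -> A}) : Type := Cochain1 {
  cochain1_map :> {linear A -> A};
  cochain1_comm : forall x : A,
    cochain1_map (alpha x) = alpha (cochain1_map x)
}.

(* No compatibility with alpha is required in degrees 2 and 3. *)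
Definition cochain2 : Type := {bilinear A -> A -> A}.

Record cochain3 : Type := Cochain3 {
  cochain3_map :> A -> A -> A -> A;
  cochain3_linear1 : forall y z : A, linear (fun x => cochain3_map x y z);
  cochain3_linear2 : forall x z : A, linear (fun y => cochain3_map x y z);
  cochain3_linear3 : forall x y : A, linear (fun z => cochain3_map x y z)
}.

Variables (mu : {bilinear A -> A -> A}) (alpha : {linear A -> A}).

Let linearD_fun (g h : A -> A) :
  linear g -> linear h -> linear (fun x => g x + h x).
Proof. by move=> lg lh a u v; rewrite lg lh scalerDr addrACA. Qed.

Let linearB_fun (g h : A -> A) :
  linear g -> linear h -> linear (fun x => g x - h x).
Proof. by move=> lg lh a u v; rewrite lg lh scalerBr opprD addrACA. Qed.

Section Delta1.
Variable f : cochain1 alpha.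

Definition delta1_fun (x y : A) : A :=
  mu (f x) y + mu x (f y) - f (mu x y).

Fact delta1_bilinear : bilinear_for *:%R *:%R delta1_fun.
Proof.
split=> w; apply: linearB_fun; try apply: linearD_fun; move=> a u v;
  by rewrite /= ?linearP ?linearPl ?linearPr ?linearP.
Qed.

HB.instance Definition _ :=
  bilinear_isBilinear.Build K A A A *:%R *:%R delta1_fun delta1_bilinear.

Definition delta1 : cochain2 := delta1_fun.
End Delta1.

Section Delta2.
Variable phi : cochain2.

(* The bracketed operator of delta^2, before composing with id + sigma_1. *)
Definition delta2_bracket (x y z : A) : A :=
  (mu (phi x y) (alpha z) - mu (alpha x) (phi y z))
  + (phi (mu x y) (alpha z) - phi (alpha x) (mu y z)).

Definition delta2_fun (x y z : A) : A :=
  delta2_bracket x y z + delta2_bracket y x z.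

Let bracket_linear1 y z : linear (fun x => delta2_bracket x y z).
Proof.
by apply: linearD_fun; apply: linearB_fun => a u v;
  rewrite /= ?linearP ?linearPl ?linearPr ?linearP.
Qed.

Let bracket_linear2 x z : linear (fun y => delta2_bracket x y z).
Proof.
by apply: linearD_fun; apply: linearB_fun => a u v;
  rewrite /= ?linearP ?linearPl ?linearPr ?linearP.
Qed.

Let bracket_linear3 x y : linear (fun z => delta2_bracket x y z).
Proof.
by apply: linearD_fun; apply: linearB_fun => a u v;
  rewrite /= ?linearP ?linearPl ?linearPr ?linearP.
Qed.

Fact delta2_linear1 y z : linear (fun x => delta2_fun x y z).
Proof. exact: linearD_fun (bracket_linear1 y z) (bracket_linear2 y z). Qed.

Fact delta2_linear2 x z : linear (fun y => delta2_fun x y z).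
Proof. exact: linearD_fun (bracket_linear2 x z) (bracket_linear1 x z). Qed.

Fact delta2_linear3 x y : linear (fun z => delta2_fun x y z).
Proof. exact: linearD_fun (bracket_linear3 x y) (bracket_linear3 y x). Qed.

Definition delta2 : cochain3 :=
  Cochain3 delta2_linear1 delta2_linear2 delta2_linear3.
End Delta2.

End HomAlternative.

Arguments cochain2 {K} A.
Arguments cochain3 {K} A.
Arguments delta1 {K A} mu alpha f.
Arguments delta2 {K A} mu alpha phi.

(* Main.v *)
Require Import Defs.
From mathcomp Require Import all_boot all_order all_algebra.

(** The Hom-associator [as(x, y, z) = (x y) alpha(z) - alpha(x) (y z)] is
    quadratic in [mu], and [delta2] is the derivative at [mu] of its
    symmetrization in the first two arguments. Since [f] commutes with [alpha],
    [delta1 f] is the tangent direction at [mu] obtained by letting the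
    infinitesimal automorphism [1 + t f] act. The Hom-associator is built from
    [mu] and [alpha] alone, hence is equivariant under this action: its
    derivative in the direction [delta1 f] is the usual action of [f] on
    trilinear maps,
    [as(f x, y, z) + as(x, f y, z) + as(x, y, f z) - f (as(x, y, z))]
    ([delta2_bracket_delta1]). Symmetrizing in [x] and [y] turns each of these
    terms into a value of the symmetrized Hom-associator, which is zero in a
    left Hom-alternative algebra ([hom_associator_skew]). *)

Import GRing.Theory.
Local Open Scope ring_scope.

Section HomAssociator.
Context {K : fieldType} {A : lmodType K}.
Context (mu : {bilinear A -> A -> A}) (alpha : {linear A -> A}).

Definition hom_associator (x y z : A) : A :=
  mu (mu x y) (alpha z) - mu (alpha x) (mu y z).

(** Polarization: left Hom-alternativity says that the Hom-associator vanishes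
    at [(x, x, z)], and expanding its value at [(x + y, x + y, z)] leaves the
    two mixed terms. *)
Lemma hom_associator_skew (A_lhalt : left_hom_alternative mu alpha) (x y z : A) :
  hom_associator x y z + hom_associator y x z = 0.
Proof.
have mixed : mu (mu x y) (alpha z) + mu (mu y x) (alpha z) =
             mu (alpha x) (mu y z) + mu (alpha y) (mu x z).
  have := A_lhalt (x + y) z.
  rewrite linearD !linearDl !linearDr !linearDl !A_lhalt.
  by rewrite -!addrA => /addrI; rewrite !addrA => /addIr.
by rewrite /hom_associator addrACA -opprD mixed subrr.
Qed.

(** The terms in which [f] is applied to an inner product, [f (x y)] or
    [f (y z)], occur twice with opposite signs; commutation of [f] with [alpha]
    identifies [f (alpha x)] with [alpha (f x)] in the remaining ones. *)
Lemma delta2_bracket_delta1 (f : cochain1 alpha) (x y z : A) :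
  delta2_bracket mu alpha (delta1 mu alpha f) x y z =
  hom_associator (f x) y z + hom_associator x (f y) z
    + hom_associator x y (f z) - f (hom_associator x y z).
Proof.
rewrite /delta2_bracket /= /delta1_fun /hom_associator !cochain1_comm.
rewrite !linearBl !linearBr !linearDl !linearDr /=.
(* With the left-bracketed products collected apart from the right-bracketed
   ones, each cancelling pair lies within one group. *)
have addBB (a b c d : A) : a - b + (c - d) = a + c - (b + d).
  by rewrite addrACA -opprD.
have subBB (a b c d : A) : a - b - (c - d) = a - c - (b - d).
  by rewrite opprD addrACA -opprD.
rewrite [f (_ - _)]linearB /= !addBB [RHS]subBB; congr (_ - _).
  by rewrite [mu (f _) _ + _]addrC addrA addrKA.
by rewrite addrA addrKA [X in X - _]addrC addrA.
Qed.
End HomAssociator.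

Theorem proposition2p2 (K : closedFieldType) (K_char0 : [pchar K] =i pred0)
    (A : lmodType K) (mu : {bilinear A -> A -> A}) (alpha : {linear A -> A})
    (A_lhalt : left_hom_alternative mu alpha) :
  forall (f : cochain1 alpha) (x y z : A),
    (delta2 mu alpha \o delta1 mu alpha) f x y z = 0.
Proof.
move=> f x y z /=; rewrite /delta2_fun !delta2_bracket_delta1.
have skew := hom_associator_skew _ _ A_lhalt.
rewrite addrACA -opprD -linearD skew linear0 subr0.
(* Exchanging the arguments also exchanges the places where f acts, so the
   first two terms pair crosswise. *)
by rewrite addrACA skew addr0 [X in _ + X]addrC addrACA !skew addr0.
Qed.
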